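(* Let $n \ge 2$ be an integer, $G = \mathfrak S_{n+1}$, and let $d$ be a positive divisor of $n+1$. Then the Solomon zeta function of the $\mathbf{Z}G$-lattice $L(d)$ is given by $$\zeta_{\mathbf{Z}G}(L(d),s) = \zeta_{\mathbf{Q}}(ns)\prod_{p \mid n+1}\varphi_{p,d}(p^{-s}),$$ where $p$ runs over all prime divisors of $n+1$, $\zeta_{\mathbf{Q}}$ denotes the Riemann zeta function, and $\varphi_{p,d}\in\mathbf{Z}[X]$ is the polynomial $$\varphi_{p,d} = \sum_{j=0}^{v_p(d)} X^j + \sum_{j=v_p(d)+1}^{v_p(n+1)} X^{(j-v_p(d))(n-1)}.$$
   Context: Let $V$ be the $n$-dimensional absolutely irreducible $\mathbf{Q}G$-module (the Specht module $S^{\lambda}$ over $\mathbf{Q}$ for the partition $\lambda=(2,1^{n-1})$ of $n+1$) with $\mathbf{Q}$-basis $(e_1,\dots,e_n)$ on which, for $1\le k\le n$, the transposition $(k\ \,k+1)$ acts by left multiplication of coordinate column vectors by the matrix $E^{k,k-1}+2E^{k,k}+E^{k,k+1}-I_n$. Here $E^{i,j}$ is the $n\times n$ matrix with a single $1$ in position $(i,j)$, and $E^{i,j}=0$ if $i$ or $j$ is not in $\{1,\dots,n\}$. Equivalently, $(k\ \,k+1)\,e_j = -e_j + c_{kj}e_k$ with $c_{kj}=2$ if $j=k$, $c_{kj}=1$ if $|j-k|=1$, and $c_{kj}=0$ otherwise. Put $v = e_n + \sum_{i=1}^{n-1}(-1)^{n+1-i}\, i\, e_i$ and, for every integer $d>0$,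 $L(d) = \bigl(\bigoplus_{i=1}^{n-1}\mathbf{Z}\,d e_i\bigr)\oplus \mathbf{Z}v \subseteq V$. It is known (Craig) that for $d\mid n+1$ the module $L(d)$ is a $\mathbf{Z}G$-lattice of $V$. For a $\mathbf{Z}G$-lattice $M$ the Solomon zeta function is $\zeta_{\mathbf{Z}G}(M,s)=\sum_{N}|M:N|^{-s}$, where $N$ runs over all $\mathbf{Z}G$-sublattices $N\subseteq M$ of finite index; identities are identities of Dirichlet series in $s$ (equivalently, of functions for $\operatorname{Re}(s)$ sufficiently large). $v_p$ denotes the $p$-adic valuation. *)

(* Defs.v *)
From mathcomp Require Import all_boot all_order all_fingroup all_algebra.
From mathcomp Require Import zify ring.
From mathcomp Require Import mxrepresentation.
From mathcomp Require Import finmap.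
From mathcomp Require Import boolp classical_sets functions cardinality.

Set Implicit Arguments.
Unset Strict Implicit.
Unset Printing Implicit Defensive.

Import GRing.Theory.
Local Open Scope ring_scope.

(* Basis vectors e_k and matrix units E^{k,l} use the 1-based numbering
   1 <= k, l <= n; both vanish as soon as an index is outside this range. *)
Definition e_ (n k : nat) : 'cV[rat]_n := \col_i ((i.+1 == k)%N)%:R.

Definition E_ (n k l : nat) : 'M[rat]_n :=
  \matrix_(i, j) ((i.+1 == k)%N && (j.+1 == l)%N)%:R.

(* The permutation of 'I_n.+1 written (k k+1) when the points are numbered
   1, ..., n+1; they are numbered 0, ..., n here. *)
Definition adj_transp (n k : nat) : 'S_n.+1 := tperm (inord k.-1) (inord k).

(* V is the space of coordinate columns, on which g acts by x |-> rG g *m x.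
   As the adjacent transpositions generate 'S_n.+1, the condition determines
   rG; it is satisfiable by specht_action_exists below. *)
Definition specht_action (n : nat)
    (rG : mx_representation rat [set: 'S_n.+1]%SET n) : Prop :=
  forall k : nat, (1 <= k <= n)%N ->
    rG (adj_transp n k) =
      E_ n k k.-1 + E_ n k k *+ 2 + E_ n k k.+1 - 1%:M.

Definition craig_v (n : nat) : 'cV[rat]_n :=
  e_ n n + \sum_(1 <= i < n) ((-1) ^+ (n + 1 - i) * i%:R) *: e_ n i.

Definition craig_L (n d : nat) : set 'cV[rat]_n :=
  [set x | exists (a : nat -> int) (b : int),
     x = \sum_(1 <= i < n) (d%:R *: e_ n i) *~ a i + craig_v n *~ b]%classic.

Arguments craig_L n d : clear implicits.

(* For M a lattice, every such N is itself a lattice, being a subgroup of a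
   finitely generated free abelian group. *)
Definition ZG_sublattice (gT : finGroupType) (n : nat)
    (rG : mx_representation rat [set: gT]%SET n) (M N : set 'cV[rat]_n) : Prop :=
  [/\ (N `<=` M)%classic,
      N 0,
      forall x y, N x -> N y -> N (x - y)
    & forall g x, N x -> N (rG g *m x)].

Definition cosets (V : zmodType) (M N : set V) : set (set V) :=
  [set [set x + y | y in N] | x in M]%classic.

Definition has_index (V : zmodType) (M N : set V) (m : nat) : Prop :=
  (cosets M N #= `I_m)%card.

Definition sublattices_of_index (gT : finGroupType) (n : nat)
    (rG : mx_representation rat [set: gT]%SET n) (M : set 'cV[rat]_n) (m : nat) :
    set (set 'cV[rat]_n) :=
  [set N | ZG_sublattice rG M N /\ has_index M N m]%classic.

(* The formal Dirichlet series \sum_(m > 0) F m * m^{-s}; the value F 0 is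
   irrelevant. *)
Definition dseries := nat -> int.

Definition dseries_eq (F H : dseries) : Prop :=
  forall m : nat, (0 < m)%N -> F m = H m.

Definition ds_one : dseries := fun m => ((m == 1)%N)%:R.

Definition ds_mul (F H : dseries) : dseries :=
  fun m => \sum_(k <- divisors m) F k * H (m %/ k)%N.

(* Meaningful when the sets involved are finite: fset_set is empty on infinite
   sets. *)
Definition solomon_zeta (gT : finGroupType) (n : nat)
    (rG : mx_representation rat [set: gT]%SET n) (M : set 'cV[rat]_n) : dseries :=
  fun m => (#|` fset_set (sublattices_of_index rG M m)|%fset)%:Z.

Definition riemann_zeta : dseries := fun=> 1.

(* F(n s), that is \sum_(k > 0) F k * (k ^ n)^{-s}, for n > 0. *)
Definition ds_scale (n : nat) (F : dseries) : dseries :=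
  fun m => \sum_(k < m.+1 | (0 < k)%N && (k ^ n == m)%N) F k.

(* f(p^{-s}), that is \sum_j f`_j * (p ^ j)^{-s}. *)
Definition ds_poly (p : nat) (f : {poly int}) : dseries :=
  fun m => \sum_(j < size f | (p ^ j == m)%N) f`_j.

Definition varphi (n p d : nat) : {poly int} :=
  \sum_(0 <= j < (logn p d).+1) 'X^j +
  \sum_((logn p d).+1 <= j < (logn p n.+1).+1)
     'X^((j - logn p d) * (n - 1))%N.

Local Ltac nat_case :=
  match goal with |- context [(?a == ?b :> nat)%N] =>
    first [ rewrite (_ : (a == b) = true); last lia
          | rewrite (_ : (a == b) = false); last lia ] end.

Section Existence.
Variable n : nat.

(* The sign twist of the permutation action on the columns of coordinate sum 0
   in rat^(n+1), in the basis of the columns of Bmx; Cmx is a left inverse. *)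
Let Bmx : 'M[rat]_(n.+1, n) :=
  \matrix_(i, j)
    ((-1) ^+ j * (((i == j :> nat)%N)%:R - ((i == j.+1 :> nat)%N)%:R)).
Let Cmx : 'M[rat]_(n, n.+1) := \matrix_(j, i) ((-1) ^+ j * ((i <= j)%N)%:R).

Let sum_ind (F : nat -> rat) (m : nat) (P : pred nat) (k : nat) :
  (k < m)%N -> \sum_(i < m | P i) F i * ((i == k :> nat)%N)%:R = (P k)%:R * F k.
Proof.
move=> km; rewrite big_mkcond (bigD1 (Ordinal km)) //= eqxx mulr1 big1.
  by rewrite addr0; case: (P k); rewrite ?mul1r ?mul0r.
move=> i /eqP ik; case: ifP => // _; case: eqP => [e|]; last by rewrite mulr0.
by case: ik; apply: val_inj.
Qed.

Let CB : Cmx *m Bmx = 1%:M.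
Proof.
apply/matrixP => i j; rewrite !mxE.
transitivity ((-1) ^+ i * (-1) ^+ j *
    (((j <= i)%N)%:R - ((j.+1 <= i)%N)%:R) : rat).
  have jn : (j < n.+1)%N by apply: ltnW; rewrite ltnS.
  have jn1 : (j.+1 < n.+1)%N by rewrite ltnS.
  have := sum_ind (fun=> 1) (fun k => k <= i)%N jn; rewrite mulr1 => <-.
  have := sum_ind (fun=> 1) (fun k => k <= i)%N jn1; rewrite mulr1 => <-.
  rewrite [X in _ = _ * (X - _)]big_mkcond [X in _ = _ * (_ - X)]big_mkcond.
  rewrite -sumrB mulr_sumr.
  apply: eq_bigr => k _; rewrite !mxE mulrACA; congr (_ * _).
  by case: ifP => _; rewrite ?subr0 ?mul0r ?mul1r.
case: (ltngtP j i) => [ji|ij|e].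
- by rewrite subrr mulr0 (_ : i == j = false) //; apply/negbTE; apply: contraTneq ji => ->; rewrite ltnn.
- by rewrite subrr mulr0 (_ : i == j = false) //; apply/negbTE; apply: contraTneq ij => ->; rewrite ltnn.
- by rewrite (val_inj e) eqxx subr0 mulr1 -expr2 sqrr_sign.
Qed.

Let BC m (M : 'M[rat]_(n.+1, m)) :
  (forall j, \sum_i M i j = 0) -> Bmx *m (Cmx *m M) = M.
Proof.
move=> M0; apply/matrixP => i j; rewrite !mxE.
pose S (k : nat) := \sum_(l < n.+1 | (l < k)%N) M l j.
have S0 : S 0%N = 0 by rewrite /S big_pred0.
have Sn : S n.+1 = 0.
  by rewrite /S -[RHS](M0 j); apply: eq_bigl => l; rewrite ltn_ord.
have SS : M i j = S i.+1 - S i.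
  rewrite /S (bigD1 i) //=.
  rewrite (eq_bigl (fun l : 'I_n.+1 => (l < i)%N)) ?addrK // => l.
  by rewrite ltnS ltn_neqAle andbC.
transitivity (\sum_(k < n) (S k.+1 * ((k == i :> nat)%N)%:R
                - S k.+1 * ((k.+1 == i :> nat)%N)%:R)).
  apply: eq_bigr => k _; rewrite !mxE.
  have -> : \sum_j0 Cmx k j0 * M j0 j = (-1) ^+ k * S k.+1.
    rewrite /S [in RHS]big_mkcond mulr_sumr /=; apply: eq_bigr => l _; rewrite !mxE ltnS.
    by case: ifP => _; rewrite ?mulr1 ?mulr0 ?mul0r.
  rewrite mulrACA -expr2 sqrr_sign mul1r -mulrBr mulrC.
  by rewrite ![(i : nat) == _]eq_sym.
rewrite sumrB SS; congr (_ - _).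
  have [ilt|ige] := ltnP i n.
    by rewrite (sum_ind (fun k => S k.+1) predT ilt) mul1r.
  have -> : (i : nat) = n by apply/eqP; rewrite eqn_leq ige -ltnS ltn_ord.
  rewrite Sn big1 // => k _.
  by rewrite (ltn_eqF (ltn_ord k)) mulr0.
case: i SS => [[|i] ilt] SS /=.
  by rewrite S0 big1 // => k _; rewrite mulr0.
under eq_bigr do rewrite eqSS.
by rewrite (sum_ind (fun k => S k.+1) predT) ?mul1r.
Qed.

Let colsum_perm m (s : 'S_n.+1) (M : 'M[rat]_(n.+1, m)) :
  (forall j, \sum_i M i j = 0) -> forall j, \sum_i (perm_mx s *m M) i j = 0.
Proof.
move=> M0 j; rewrite -[RHS](M0 j) [RHS](reindex_inj (@perm_inj _ s)).
by apply: eq_bigr => i _; rewrite -row_permE mxE.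
Qed.

Let colsumB j : \sum_i Bmx i j = 0.
Proof.
under eq_bigr do rewrite mxE.
rewrite -mulr_sumr sumrB.
have H k : (k < n.+1)%N -> \sum_(i < n.+1) ((i == k :> nat)%N)%:R = 1 :> rat.
  move=> kn; apply: etrans (etrans (sum_ind (fun=> 1) predT kn) (mul1r _)).
  by apply: eq_bigr => i _; rewrite mul1r.
by rewrite !H ?subrr ?mulr0 // ?ltnS // ltnW // ltnS.
Qed.

Let rho (g : 'S_n.+1) : 'M[rat]_n :=
  (-1) ^+ g *: (Cmx *m (perm_mx g *m Bmx)).

Let rho_repr : mx_repr [set: 'S_n.+1]%SET rho.
Proof.
split=> [|g h _ _].
  by rewrite /rho odd_perm1 expr0 scale1r perm_mx1 mul1mx CB.
rewrite /rho odd_permM signr_addb -scalemxAl -scalemxAr scalerA; congr (_ *: _).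
rewrite perm_mxM -!mulmxA BC //.
exact: colsum_perm colsumB.
Qed.

Let sgE k : (-1 : rat) ^+ k.+1 = - (-1) ^+ k.
Proof. by rewrite exprS mulN1r. Qed.

Lemma specht_action_exists :
  exists rG : mx_representation rat [set: 'S_n.+1]%SET n, specht_action rG.
Proof.
exists (MxRepresentation rho_repr) => k /andP[k0 kn] /=.
case: k k0 kn => // k _ kn; rewrite /=.
have kne : inord k != inord k.+1 :> 'I_n.+1.
  by rewrite -val_eqE /= !inordK ?ltnS // ?neq_ltn ?ltnSn // ltnW.
rewrite /rho /adj_transp odd_tperm kne expr1 scaleN1r.
set E := (X in _ = X).
suff HB : perm_mx (tperm (inord k) (inord k.+1)) *m Bmx = - (Bmx *m E).
  by rewrite HB mulmxN opprK mulmxA CB mul1mx.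
rewrite /E mulmxBr mulmx1 opprB -row_permE.
have BE l' : Bmx *m E_ n k.+1 l' = \matrix_(i, j)
   ((-1) ^+ k * (((i == k :> nat)%N)%:R - ((i == k.+1 :> nat)%N)%:R)
     * ((j.+1 == l')%N)%:R).
  apply/matrixP => i j.
  rewrite !mxE (bigD1 (Ordinal kn)) //= !mxE eqxx /= big1 ?addr0 // => a.
  by rewrite -val_eqE /= => ak; rewrite !mxE eqSS (negbTE ak) mulr0.
rewrite mulr2n !mulmxDr !BE.
apply/matrixP => i j; rewrite !mxE !eqSS.
have vk : (inord k : 'I_n.+1) = k :> nat by rewrite inordK // ltnS ltnW.
have vk1 : (inord k.+1 : 'I_n.+1) = k.+1 :> nat by rewrite inordK // ltnS.
have -> : tperm (inord k) (inord k.+1) i =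
    (if (i == k :> nat)%N then k.+1 else if (i == k.+1 :> nat)%N then k else i)
    :> nat.
  case: tpermP => [->|->|/eqP ik /eqP ik1]; first by rewrite vk eqxx.
    by rewrite vk1 eqxx eqn_leq ltnn.
  by move: ik ik1; rewrite -!val_eqE /= vk vk1 => /negbTE-> /negbTE->.
case: i => i _ /=; case: j => j jn /=.
have [->|n1] := eqVneq i k; last have [->|n2] := eqVneq i k.+1.
- case: (eqVneq j.+1 k) => [<-|?]; first by rewrite ?sgE; do ?nat_case; rewrite /=; ring.
  case: (eqVneq j k) => [<-|?]; first by do ?nat_case; rewrite /=; ring.
  case: (eqVneq j k.+1) => [->|?]; first by rewrite ?sgE; do ?nat_case; rewrite /=; ring.
  by do ?nat_case; rewrite /=; ring.
- case: (eqVneq j.+1 k) => [<-|?]; first by rewrite ?sgE; do ?nat_case; rewrite /=; ring.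
  case: (eqVneq j k) => [<-|?]; first by do ?nat_case; rewrite /=; ring.
  case: (eqVneq j k.+1) => [->|?]; first by rewrite ?sgE; do ?nat_case; rewrite /=; ring.
  by do ?nat_case; rewrite /=; ring.
- by rewrite /=; ring.
Qed.

End Existence.

(* Main.v *)
(* Up to a sign, V is the span of the root lattice of type A_n with (k k+1)
   acting as the reflection in e_k, so (1 + (k k+1)) x is a multiple of e_k for
   every x.  Hence a sublattice N of finite index contains c e_k for all k,
   where c is the least such multiplier, and it lies in c times the weight
   lattice; as the weight lattice modulo the root lattice is cyclic of order
   n + 1, N is determined by c and by the order D | n + 1 of its image in that
   quotient.  In the basis e_1, ..., e_{n-1}, v all these lattices are diagonal:
   N = <c e_1, ..., c e_{n-1}, (c / D) v>, and those inside L(d) are obtained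
   with c = k lcm(d, D) for k > 0.  The index in L(d) is
   k^n (d/g) (D/g)^{n-1} with g = gcd(d, D); the factor k^n accounts for
   zeta(ns), and the rest is multiplicative in (d, D), which gives the Euler
   factors varphi. *)
Require Import Defs.
From mathcomp Require Import all_boot all_order all_fingroup all_algebra.
From mathcomp Require Import mxrepresentation.
From mathcomp Require Import finmap.
From mathcomp Require Import boolp classical_sets functions cardinality.
From mathcomp Require Import zify ring.
Local Open Scope ring_scope.
Import GRing.Theory.

(** * Dirichlet series attached to finite sequences *)

(** Encodes a finite Dirichlet sum as the multiset of its bases, so that identities of series become
    [perm_eq] of lists. *)
Definition ds_of_seq (s : seq nat) : dseries := fun m => (count_mem m s)%:Z.

(** Convolution at m reads its factors only at divisors of m. This permits rewriting with
    [dseries_eq], which is silent at 0, and with truncations valid only up to m. *)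
Lemma eq_ds_mul (F F' H H' : dseries) (m : nat) : (0 < m)%N ->
  (forall k, (k %| m)%N -> F k = F' k) -> (forall k, (k %| m)%N -> H k = H' k) ->
  ds_mul F H m = ds_mul F' H' m.
Proof.
move=> m0 eF eH; apply: eq_big_seq => k; rewrite -dvdn_divisors // => km.
by rewrite eF // eH // dvdn_div.
Qed.

(** Induction on [s]: for a fixed entry x >= 1 only the divisor k = x contributes, and it counts the
    y in [t] with x y = m. *)
Lemma ds_mul_seq (s t : seq nat) : all (leq 1) s ->
  dseries_eq (ds_mul (ds_of_seq s) (ds_of_seq t))
             (ds_of_seq [seq (x * y)%N | x <- s, y <- t]).
Proof.
move=> s0 m m0; rewrite /ds_mul /ds_of_seq.
elim: s s0 => [_|x s IH /= /andP[x0 s0]].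
  by rewrite big1 // => k _; rewrite mul0r.
rewrite count_cat PoszD -(IH s0).
under eq_bigr do rewrite /= PoszD mulrDl.
rewrite big_split; congr (_ + _) => /=; rewrite count_map.
have [xm|nxm] := boolP (x %| m)%N.
  rewrite (bigD1_seq x) ?divisors_uniq -?dvdn_divisors //=.
  rewrite eqxx mul1r big1 ?addr0 => [|k kx]; last first.
    by rewrite eq_sym (negbTE kx) mul0r.
  congr (Posz _); apply: eq_count => y /=.
  by rewrite -{2}(divnK xm) mulnC eqn_pmul2r // eq_sym.
rewrite big1_seq => [|k /=]; last first.
  rewrite -dvdn_divisors //; case: eqP => [<-|_ _]; last by rewrite mul0r.
  by rewrite (negbTE nxm).
rewrite (eq_count (a2 := pred0)) ?count_pred0 // => y /=.
by apply/negbTE; apply: contra nxm => /eqP <-; apply: dvdn_mulr.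
Qed.

Lemma ds_poly_seq (p : nat) (s : seq nat) :
  (1 < p)%N ->
  dseries_eq (ds_poly p (\sum_(e <- s) 'X^e)) (ds_of_seq [seq (p ^ e)%N | e <- s]).
Proof.
move=> p1 m m0; rewrite /ds_poly /ds_of_seq; set f := \sum_(e <- s) _.
have fE j : f`_j = (count_mem j s)%:Z.
  rewrite coef_sum -sum1_count -[RHS]natz natr_sum [RHS]big_mkcond /=.
  by apply: eq_bigr => e _; rewrite coefXn eq_sym; case: eqP.
rewrite count_map -[RHS]natz -sum1_count natr_sum [RHS]big_mkcond /=.
under eq_bigr do rewrite coef_sum.
rewrite exchange_big /=; apply: eq_big_seq => e es.
(* Coefficients of [f] are multiplicities, so nothing cancels and every exponent in [s] lies below
   [size f]. *)
have ef : (e < size f)%N.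
  rewrite ltnNge; apply: contraTN es => /leq_sizeP /(_ _ (leqnn e)).
  by rewrite fE => -[/eqP]; rewrite -leqn0 leqNgt -has_count has_pred1.
rewrite big_mkcond (bigD1 (Ordinal ef)) //= coefXn eqxx big1 ?addr0.
  by rewrite eq_sym.
move=> j je; rewrite coefXn (_ : (j : nat) == e = false) ?if_same //.
by apply: contraNF je => /eqP je; apply/eqP/val_inj.
Qed.

(** * Multiplicativity of the index and the Euler product *)

(** Prime by prime: at each q, one of a, e and one of b, c has valuation 0, and then the minimum of
    the sums is the sum of the minima. *)
Lemma gcdn_mul_coprime (a b c e : nat) :
  (0 < a)%N -> (0 < b)%N -> (0 < c)%N -> (0 < e)%N ->
  coprime a e -> coprime b c ->
  gcdn (a * b) (c * e) = (gcdn a c * gcdn b e)%N.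
Proof.
move=> a0 b0 c0 e0 /eqP ae /eqP bc.
apply: eqn_from_log; rewrite ?muln_gt0 ?gcdn_gt0 ?muln_gt0 ?a0 ?b0 // => q.
have := logn_gcd q a0 e0; have := logn_gcd q b0 c0.
rewrite ae bc logn1 logn_gcd ?muln_gt0 ?a0 ?b0 ?c0 ?e0 //.
rewrite !lognM ?gcdn_gt0 ?a0 ?b0 // !logn_gcd //; lia.
Qed.

(* The index in L(d) of the sublattice with parameters k = 1 and D. *)
Definition primitive_index (n d D : nat) : nat :=
  (d %/ gcdn d D * (D %/ gcdn d D) ^ (n - 1))%N.

Lemma primitive_index_gt0 (n d D : nat) :
  (0 < d)%N -> (0 < D)%N -> (0 < primitive_index n d D)%N.
Proof.
move=> d0 D0; have g0 : (0 < gcdn d D)%N by rewrite gcdn_gt0 d0.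
rewrite muln_gt0 expn_gt0 !divn_gt0 //.
by rewrite (dvdn_leq d0 (dvdn_gcdl d D)) (dvdn_leq D0 (dvdn_gcdr d D)).
Qed.

Lemma primitive_index_mul (n d1 d2 D1 D2 : nat) :
  (0 < d1)%N -> (0 < d2)%N -> (0 < D1)%N -> (0 < D2)%N ->
  coprime d1 D2 -> coprime d2 D1 ->
  primitive_index n (d1 * d2) (D1 * D2) =
    (primitive_index n d1 D1 * primitive_index n d2 D2)%N.
Proof.
move=> d10 d20 D10 D20 c1 c2; rewrite /primitive_index gcdn_mul_coprime //.
have divMM (a b g h : nat) : (0 < g)%N -> (0 < h)%N -> (g %| a)%N -> (h %| b)%N ->
    (a * b %/ (g * h) = a %/ g * (b %/ h))%N.
  move=> g0 h0 /dvdnP[x ->] /dvdnP[y ->].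
  by rewrite mulnACA !mulnK ?muln_gt0 ?g0.
rewrite !divMM ?gcdn_gt0 ?d10 ?d20 ?dvdn_gcdl ?dvdn_gcdr //.
by rewrite expnMn mulnACA.
Qed.

(** Reversing the first sum turns X^j into X^(v_p(d) - j). By truncated subtraction a single
    exponent then covers both ranges, and it is the one of [primitive_index] at prime powers. *)
Lemma varphiE (n p d : nat) : (logn p d <= logn p n.+1)%N ->
  varphi n p d =
    \sum_(e <- [seq (logn p d - j + (j - logn p d) * (n - 1))%N
               | j <- iota 0 (logn p n.+1).+1]) 'X^e.
Proof.
move=> da; rewrite big_map /varphi.
rewrite -[iota 0 _]/(index_iota 0 (logn p n.+1).+1).
rewrite [RHS](big_cat_nat (n := (logn p d).+1)) //=; congr (_ + _).
  rewrite big_nat_rev /= add0n; apply: eq_big_nat => j /andP[_ jd].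
  by rewrite subSS (_ : (j - logn p d)%N = 0%N) ?addn0 //; lia.
apply: eq_big_nat => j /andP[dj _].
by rewrite (_ : (logn p d - j)%N = 0%N) //; lia.
Qed.

Lemma primitive_index_prime_power (n p a b : nat) : (1 < p)%N ->
  primitive_index n (p ^ a) (p ^ b) = (p ^ (a - b + (b - a) * (n - 1)))%N.
Proof.
move=> p1; rewrite /primitive_index.
have [ab|/ltnW ba] := leqP a b.
  rewrite (gcdn_idPl _) ?dvdn_exp2l // -!expnB ?(ltnW p1) //.
  by rewrite subnn (eqP ab) mul1n add0n expnM.
rewrite (gcdn_idPr _) ?dvdn_exp2l // -!expnB ?(ltnW p1) //.
by rewrite subnn (eqP ba) exp1n muln1 addn0.
Qed.

Lemma perm_divisors_mul (a b : nat) : (0 < a)%N -> (0 < b)%N -> coprime a b ->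
  perm_eq [seq (x * y)%N | x <- divisors a, y <- divisors b] (divisors (a * b)).
Proof.
move=> a0 b0 ab; have ab0 : (0 < a * b)%N by rewrite muln_gt0 a0.
(* The factor x is recovered from x y as its gcd with a, which gives injectivity of the product
   map. *)
have gcdE x y : (x %| a)%N -> (y %| b)%N -> gcdn (x * y) a = x.
  move=> xa yb; rewrite -[in LHS](muln1 a) gcdn_mul_coprime //
    ?coprimen1 ?gcdn1 ?muln1 //.
  - exact/gcdn_idPl.
  - exact: dvdn_gt0 xa.
  - exact: dvdn_gt0 yb.
  - by rewrite coprime_sym; apply: coprime_dvdr yb ab.
apply: uniq_perm; rewrite ?divisors_uniq //; last move=> z.
  apply: allpairs_uniq; rewrite ?divisors_uniq // => -[x y] [x' y'].
  move=> /allpairsP[[? ?] [/= + + [-> ->]]] /allpairsP[[? ?] [/= + + [-> ->]]].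
  rewrite -!dvdn_divisors // => xa yb xa' yb' /= e.
  have ex := gcdE _ _ xa yb; rewrite e gcdE // in ex.
  by move/eqP: e; rewrite ex eqn_pmul2l ?(dvdn_gt0 a0 xa) // => /eqP->.
rewrite -dvdn_divisors //; apply/allpairsP/idP => [[[x y] /= []]|zab].
  by rewrite -!dvdn_divisors // => xa yb ->; apply: dvdn_mul.
exists (gcdn z a, gcdn z b); rewrite -!dvdn_divisors // !dvdn_gcdr; split=> //=.
have z0 := dvdn_gt0 ab0 zab.
apply: eqn_from_log; rewrite ?muln_gt0 ?gcdn_gt0 ?z0 // => q.
rewrite lognM ?gcdn_gt0 ?z0 // !logn_gcd //.
have := dvdn_leq_log q ab0 zab; rewrite lognM //.
by have := logn_gcd q a0 b0; rewrite (eqP ab) logn1; lia.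

Qed.

Lemma perm_divisors_pfactor (p a : nat) : prime p ->
  perm_eq (divisors (p ^ a)) [seq (p ^ j)%N | j <- iota 0 a.+1].
Proof.
move=> pp; have p0 := prime_gt0 pp; apply: uniq_perm; rewrite ?divisors_uniq //.
  rewrite map_inj_uniq ?iota_uniq // => i j /eqP.
  by rewrite eqn_exp2l ?prime_gt1 // => /eqP.
move=> z; rewrite -dvdn_divisors ?expn_gt0 ?p0 //.
apply/dvdn_pfactor/mapP => // -[j]; last by rewrite mem_iota => ja ->; exists j.
by move=> ja ->; exists j; rewrite ?mem_iota.
Qed.

Lemma coprime_prod_primes (p : nat) (s : seq nat) (f : nat -> nat) :
  prime p -> all prime s -> p \notin s -> coprime p (\prod_(q <- s) q ^ f q)%N.
Proof.
move=> pp; elim: s => [|q s IH] /=; first by rewrite big_nil coprimen1.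
case/andP=> pq ps; rewrite inE negb_or => /andP[npq nps].
rewrite big_cons coprimeMr IH // andbT coprimeXr //.
by rewrite prime_coprime // dvdn_prime2.
Qed.

(** Induction on the primes: the divisors of p^a Q with p prime to Q are the p^j D with j <= a and D
    | Q, and [primitive_index] splits accordingly. Only the [s]-parts of d and n+1 occur, which
    keeps the statement inductive. *)
Lemma prod_ds_poly_varphi (n d : nat) (s : seq nat) :
  (0 < d)%N -> (d %| n.+1)%N -> all prime s -> uniq s ->
  dseries_eq (\big[ds_mul/ds_one]_(p <- s) ds_poly p (varphi n p d))
    (ds_of_seq [seq primitive_index n (\prod_(p <- s) p ^ logn p d) D
               | D <- divisors (\prod_(p <- s) p ^ logn p n.+1)]).
Proof.
move=> d0 dn; elim: s => [_ _|p s IH /= /andP[pp ps] /andP[nps us]] m m0.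
  rewrite !big_nil /ds_of_seq /= /primitive_index gcdnn divnn exp1n addn0 eq_sym.
  by rewrite /ds_one natz eq_sym.
have {IH} IH := IH ps us; rewrite !big_cons.
set P := (\prod_(q <- s) q ^ logn q d)%N in IH *.
set Q := (\prod_(q <- s) q ^ logn q n.+1)%N in IH *.
have pP : coprime p P by apply: coprime_prod_primes.
have pQ : coprime p Q by apply: coprime_prod_primes.
have gt0 f : (0 < \prod_(q <- s) q ^ f q)%N.
  elim: s ps {nps us P Q IH pP pQ} => [|q s IH /= /andP[/prime_gt0 q0 ps]].
    by rewrite big_nil.
  by rewrite big_cons muln_gt0 expn_gt0 q0 IH.
have [p0 p1] := (prime_gt0 pp, prime_gt1 pp).
have da : (logn p d <= logn p n.+1)%N by apply: dvdn_leq_log.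
rewrite varphiE //.
rewrite (eq_ds_mul _ _ _ _ m m0 (fun k km => ds_poly_seq _ _ p1 k (dvdn_gt0 m0 km))
  (fun k km => IH k (dvdn_gt0 m0 km))) -map_comp.
rewrite ds_mul_seq ?all_map //; last by apply/allP => j _ /=; rewrite expn_gt0 p0.
rewrite /ds_of_seq; congr (Posz _); apply: (elimT seq.permP _ (pred1 m)).
rewrite perm_sym.
apply: (perm_trans (perm_map _ _)).
  rewrite perm_sym; apply: perm_divisors_mul; rewrite ?expn_gt0 ?p0 ?gt0 //.
  by rewrite coprimeXl.
apply: (perm_trans (perm_map _ (perm_allpairs _ (perm_divisors_pfactor _ _ pp)
  (perm_refl _)))).
rewrite map_allpairs allpairs_mapl [X in perm_eq _ X]allpairs_mapr.
rewrite allpairs_mapl.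
set s1 := flatten _; set s2 := flatten _; suff -> : s1 = s2 by [].
apply/eq_in_allpairs => j D _; rewrite -dvdn_divisors ?gt0 // => DQ /=.
rewrite primitive_index_mul ?expn_gt0 ?p0 ?gt0 ?(dvdn_gt0 _ DQ) ?gt0 //.
- by rewrite primitive_index_prime_power.
- by rewrite coprimeXl //; apply: coprime_dvdr DQ pQ.
- by rewrite coprimeXr // coprime_sym.
Qed.

Lemma prod_primes_dvdn (d n : nat) : (0 < n)%N -> (d %| n)%N ->
  (\prod_(p <- primes n) p ^ logn p d)%N = d.
Proof.
move=> n0 dn; have d0 := dvdn_gt0 n0 dn.
have := part_pnat_id (pnat_dvd dn (pnat_pi n0)).
rewrite (widen_partn _ (dvdn_leq n0 dn)) -big_filter => {2}<-.
apply: perm_big; apply: uniq_perm; rewrite ?primes_uniq ?filter_uniq ?iota_uniq //.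
move=> p; rewrite mem_filter mem_iota /= add0n subn0 ltnS.
apply/idP/andP => [pn|[]//]; split=> //.
by move: pn; rewrite mem_primes => /and3P[_ _]; apply: dvdn_leq.
Qed.

(** * Subgroups and indices *)

Definition subgroup {V : zmodType} (N : set V) : Prop :=
  N 0 /\ forall x y, N x -> N y -> N (x - y).

Lemma subgroupD {V : zmodType} (N : set V) (x y : V) :
  subgroup N -> N x -> N y -> N (x + y).
Proof.
by case=> N0 NB Nx Ny; have := NB _ _ Nx (NB _ _ N0 Ny); rewrite sub0r opprK.
Qed.

Lemma subgroupMz {V : zmodType} (N : set V) (x : V) (k : int) :
  subgroup N -> N x -> N (x *~ k).
Proof.
move=> NG Nx; have [N0 NB] := NG.
have Nn m : N (x *+ m) by elim: m => // m IH; rewrite mulrS; apply: subgroupD.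
case: k => m; first exact: Nn.
by have := NB _ _ N0 (Nn m.+1); rewrite sub0r NegzE mulrNz.
Qed.

Lemma subgroup_int_dvd (P : set int) : subgroup P ->
  (exists2 x, P x & x != 0) ->
  exists2 g : nat, (0 < g)%N & forall x, P x <-> (g %| x)%Z.
Proof.
move=> PG [x0 Px0 nx0]; have [P0 PB] := PG.
have Pabs x : P x -> P `|x|%N.
  case: x => // m Pm; rewrite abszE.
  by have := PB _ _ P0 Pm; rewrite sub0r NegzE opprK.
have ex : exists g : nat, (0 < g)%N && `[< P g >].
  by exists `|x0|%N; rewrite absz_gt0 nx0; apply/asboolP/Pabs.
case: (ex_minnP ex) => g /andP[g0 /asboolP Pg] gmin.
exists g => // x; split=> [Px|/dvdzP[k ->]]; last first.
  by have := subgroupMz _ _ k PG Pg; rewrite -mulrzr intz mulrC.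
have Pr : P (x %% g)%Z.
  have -> : (x %% g)%Z = x - Posz g *~ (x %/ g)%Z.
    by rewrite -mulrzr intz mulrC {2}(divz_eq x g) [_ * _ + _]addrC addrK.
  by apply: PB => //; apply: subgroupMz.
apply: contraT => ng.
have := gmin `|(x %% g)%Z|%N; rewrite absz_gt0.
have -> : (x %% g)%Z != 0 by apply: contra ng => /eqP h; apply/dvdz_mod0P.
have -> /= : `[< P `|(x %% g)%Z|%N >] by apply/asboolP/Pabs.
move/(_ isT); rewrite leqNgt -ltz_nat gez0_abs ?modz_ge0 ?ltz_pmod //; lia.
Qed.

Lemma mem_coset {V : zmodType} (N : set V) (x y : V) : subgroup N ->
  N (x - y) <-> [set x + z | z in N]%classic = [set y + z | z in N]%classic.
Proof.
move=> NG; have [N0 NB] := NG; split=> [Nxy|e].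
  apply/seteqP; split=> _ [z Nz <-].
    by exists ((x - y) + z); [apply: subgroupD | rewrite addrA addrCA subrr addr0].
  exists (z - (x - y)); first exact: NB.
  by rewrite opprB addrCA [x + _]addrC subrK addrC.
have : [set x + z | z in N]%classic x by exists 0; rewrite ?addr0.
by rewrite e => -[z Nz <-]; rewrite addrC addKr.
Qed.

Lemma has_index_card {V : zmodType} (M N : set V) (T : finType) (r : T -> V) :
  subgroup N -> (forall t, M (r t)) ->
  (forall t t', N (r t - r t') -> t = t') ->
  (forall x, M x -> exists t, N (x - r t)) ->
  has_index M N #|T|.
Proof.
move=> NG Mr rinj rsurj; rewrite /has_index.
have -> : cosets M N =
    [set [set r (enum_val i) + y | y in N] | i in [set: 'I_#|T|]]%classic.
  apply/seteqP; split=> _ [x Mx <-].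
    have [t Nt] := rsurj _ Mx; exists (enum_rank t) => //.
    by rewrite enum_rankK; apply/esym/mem_coset.
  by exists (r (enum_val x)).
apply: card_eq_trans (inj_card_eq _) _ => [i j _ _ /(mem_coset _ _ _ NG) /rinj|].
  exact: enum_val_inj.
by rewrite card_eq_sym card_II.
Qed.

(** Pigeonhole: if no positive multiple of x lay in N, the m+1 cosets of 0, x, ..., m x would be
    distinct. *)
Lemma has_index_torsion {V : zmodType} (M N : set V) (m : nat) (x : V) :
  subgroup M -> subgroup N -> has_index M N m -> M x ->
  exists2 e : nat, (0 < e)%N & N (x *+ e).
Proof.
move=> MG NG MN Mx; apply: contrapT => nex.
pose f i := [set x *+ i + y | y in N]%classic.
have finj : {in `I_m.+1%classic &, injective f}.
  move=> i j _ _ /(mem_coset _ _ _ NG).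
  wlog ij : i j / (i <= j)%N => [wl Nij|].
    have [/wl|/ltnW /wl h] := leqP i j; first exact.
    by apply/esym/h; rewrite -opprB -sub0r; apply: (proj2 NG) => //; case: NG.
  move=> Nij; apply/eqP; rewrite eqn_leq ij leqNgt; apply/negP => lij; apply: nex.
  exists (j - i)%N; first by rewrite subn_gt0.
  by rewrite mulrnBr // -opprB -sub0r; apply: (proj2 NG) => //; case: NG.
have : (`I_m.+1 #<= `I_m)%card.
  rewrite -(card_le_eqr MN) -(card_le_eql (inj_card_eq finj)).
  apply: subset_card_le => _ [i _ <-]; exists (x *+ i) => //.
  by rewrite pmulrn; apply: subgroupMz.
by rewrite card_le_II ltnn.
Qed.

Lemma gen_adj_transp (n : nat) :
  <<[set adj_transp n k.+1 | k : 'I_n]>>%g = [set: 'S_n.+1].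
Proof.
apply/eqP; rewrite finset.eqEsubset finset.subsetT /=.
rewrite -(gen_tperm (ord0 : 'I_n.+1)) gen_subG.
apply/fintype.subsetP => _ /imsetP[i _ ->].
have H (k : nat) : (k < n)%N -> tperm (inord k) (inord k.+1) \in
    <<[set adj_transp n k.+1 | k : 'I_n]>>%g.
  by move=> kn; apply/mem_gen/imsetP; exists (Ordinal kn).
rewrite -[i]inord_val; elim: (i : nat) (ltn_ord i) => [|k IH] kn.
  by rewrite (_ : inord 0 = ord0) ?tperm1 ?group1 //; apply: val_inj; rewrite /= inordK.
case: (posnP k) kn => [->|k0] kn.
  have := H 0%N kn.
  by rewrite (_ : inord 0 = ord0) ?H //; apply: val_inj; rewrite /= inordK.
have kz : inord k != inord k.+1 :> 'I_n.+1.
  by rewrite -val_eqE /= (inordK (ltnW kn)) (inordK kn) neq_ltn ltnSn.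
have z0 : ord0 != inord k.+1 :> 'I_n.+1 by rewrite -val_eqE /= inordK.
(* Conjugating (k k+1) by (k 0) yields (0 k+1); the transpositions through 0 generate the group by
   [gen_tperm]. *)
by rewrite -(tpermJ_tperm kz z0) groupJ ?H // tpermC IH // ltnW.
Qed.

(** * Coordinates and the action of adjacent transpositions *)

(* Junk value: ecoord x k = 0 unless 1 <= k <= n. *)
Definition ecoord {n : nat} (x : 'cV[rat]_n) (k : nat) : rat :=
  ((e_ n k)^T *m x) 0 0.

Lemma ecoord_ord {n : nat} (x : 'cV[rat]_n) (i : 'I_n) : ecoord x i.+1 = x i 0.
Proof.
rewrite /ecoord mxE (bigD1 i) //= !mxE eqxx mul1r big1 ?addr0 // => j ji.
by rewrite !mxE eqSS (inj_eq val_inj) (negbTE ji) mul0r.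
Qed.

Lemma ecoord_ext {n : nat} (x y : 'cV[rat]_n) :
  (forall k, (0 < k <= n)%N -> ecoord x k = ecoord y k) -> x = y.
Proof.
move=> xy; apply/colP => i; rewrite -!ecoord_ord xy //=; exact: ltn_ord.
Qed.

Lemma ecoordD {n : nat} (x y : 'cV[rat]_n) k :
  ecoord (x + y) k = ecoord x k + ecoord y k.
Proof. by rewrite /ecoord mulmxDr mxE. Qed.

Lemma ecoordZ {n : nat} (r : rat) (x : 'cV[rat]_n) k :
  ecoord (r *: x) k = r * ecoord x k.
Proof. by rewrite /ecoord -scalemxAr mxE. Qed.

Lemma ecoord_e (n j k : nat) :
  ecoord (e_ n j) k = ((j == k) && (0 < k <= n))%N%:R.
Proof.
case: k => [|k]; last have [kn|nk] := ltnP k n.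
- by rewrite andbF /ecoord mxE big1 // => i _; rewrite !mxE mul0r.
- by have := ecoord_ord (e_ n j) (Ordinal kn); rewrite /= => ->; rewrite mxE /= eq_sym andbT.
rewrite !andbF /ecoord mxE big1 // => i _; rewrite !mxE eqSS.
by rewrite (ltn_eqF (leq_trans (ltn_ord i) nk)) mul0r.
Qed.

Lemma ecoord_sum_e (n k : nat) (f : nat -> rat) :
  ecoord (\sum_(1 <= i < n) f i *: e_ n i) k = if (0 < k < n)%N then f k else 0.
Proof.
rewrite /ecoord mulmx_sumr summxE.
under eq_bigr do rewrite -/(ecoord _ _) ecoordZ ecoord_e.
case: ifP => [kn|nkn]; last first.
  apply: big1_seq => i; rewrite mem_index_iota => /= ir.
  have -> : i == k = false by apply: contraFF nkn => /eqP <-.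
  by rewrite mulr0.
rewrite (bigD1_seq k) ?mem_index_iota ?iota_uniq //= eqxx /=.
rewrite (_ : (0 < k <= n)%N) ?mulr1; last by case/andP: kn => -> /ltnW.
by rewrite big1 ?addr0 // => i /negbTE ->; rewrite mulr0.
Qed.

Lemma E_mul (n k l : nat) (x : 'cV[rat]_n) : E_ n k l *m x = ecoord x l *: e_ n k.
Proof.
have -> : E_ n k l = e_ n k *m (e_ n l)^T.
  by apply/matrixP => i j; rewrite !mxE big_ord1 !mxE -mulnb natrM.
by rewrite -mulmxA [_ *m x]mx11_scalar mul_mx_scalar.
Qed.

Lemma specht_action_mul (n k : nat) (rG : mx_representation rat [set: 'S_n.+1]%SET n)
    (x : 'cV[rat]_n) :
  specht_action rG -> (0 < k <= n)%N ->
  rG (adj_transp n k) *m x =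
    (ecoord x k.-1 + ecoord x k *+ 2 + ecoord x k.+1) *: e_ n k - x.
Proof.
move=> act kn; rewrite act // mulmxBl mul1mx !mulmxDl !E_mul -!scalerDl.
by rewrite mulr2n.
Qed.

(** * Coordinates in the basis e_1, ..., e_{n-1}, v *)

Definition craig_comb (n : nat) (a : nat -> int) (b : int) : 'cV[rat]_n :=
  \sum_(1 <= i < n) e_ n i *~ a i + craig_v n *~ b.

(** Zero padding lets the neighbours k-1 and k+1 be read at both ends of the range; index n is
    padded too, since e_n is not a basis vector here. *)
Definition trunc_coef (n : nat) (a : nat -> int) (k : nat) : int :=
  if (0 < k < n)%N then a k else 0.

(* The coordinates of v, extended by 0 at indices 0 and > n. *)
Definition vcoef (n k : nat) : int :=
  if k == n then 1 else if (k < n)%N then (-1) ^+ (n + 1 - k) * k%:Z else 0.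

Lemma ecoord_comb (n : nat) (a : nat -> int) (b : int) (k : nat) : (0 < n)%N ->
  ecoord (craig_comb n a b) k = (trunc_coef n a k + b * vcoef n k)%:~R.
Proof.
move=> n0; rewrite /craig_comb -[craig_v n *~ b]scaler_int.
under eq_bigr do rewrite -scaler_int.
rewrite !(ecoordD, ecoordZ) !ecoord_sum_e ecoord_e /trunc_coef /vcoef.
rewrite rmorphD rmorphM /=; congr (_ + _ * _); first by case: ifP.
rewrite eq_sym; have [->|kn] := eqVneq k n; first by rewrite n0 leqnn ltnn addr0.
rewrite add0r andbC; case: ltnP => //= kln; case: k kn kln => [|k] kn kln /=.
  by rewrite mulr0.
by rewrite rmorphM rmorphXn rmorphN1.
Qed.

(** The vector e_n occurs in v alone, with coefficient 1, so the n-th coordinate isolates b. *)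
Lemma comb_inj (n : nat) (a a' : nat -> int) (b b' : int) : (0 < n)%N ->
  craig_comb n a b = craig_comb n a' b' ->
  (forall k, (0 < k < n)%N -> a k = a' k) /\ b = b'.
Proof.
move=> n0 e.
have ek k : trunc_coef n a k + b * vcoef n k = trunc_coef n a' k + b' * vcoef n k.
  by apply: (@intr_inj rat); rewrite -!ecoord_comb // e.
have bb : b = b'.
  by have := ek n; rewrite /trunc_coef /vcoef ltnn andbF eqxx !add0r !mulr1.
split=> // k kn; have := ek k; rewrite bb /trunc_coef kn; exact: addIr.
Qed.

Lemma combB (n : nat) (a a' : nat -> int) (b b' : int) :
  craig_comb n a b - craig_comb n a' b' =
    craig_comb n (fun k => a k - a' k) (b - b').
Proof.
rewrite /craig_comb opprD addrACA -sumrB mulrzBr; congr (_ + _).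
by apply: eq_bigr => i _; rewrite mulrzBr.
Qed.

(** The distance n - k is written j+1 so that the sign exponent n+1-k becomes j+2, free of
    subtraction. *)
Lemma vcoefE (n k j : nat) : (n = k + j.+1)%N -> vcoef n k = (-1) ^+ j.+2 * k%:Z.
Proof.
move=> ->; rewrite /vcoef addnS addn1 -addSn ltnS leq_addr ltn_eqF ?leq_addr //.
by rewrite addSn -!addnS addKn.
Qed.

Lemma vcoef_diag (n : nat) : vcoef n n = 1.
Proof. by rewrite /vcoef eqxx. Qed.

Lemma vcoef_gt (n k : nat) : (n < k)%N -> vcoef n k = 0.
Proof. by move=> nk; rewrite /vcoef gtn_eqF // ltnNge (ltnW nk). Qed.

(** The sequence (-1)^(n+1-k) k is annihilated by this second-order sum. The coordinates of v
    deviate from it by n+1 at index n (1 for -n) and by -(n+1) at index n+1 (0 for n+1), which is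
    felt only at the last two k. *)
Lemma vcoef_reflection (n k : nat) : (0 < k <= n)%N ->
  vcoef n k.-1 + vcoef n k *+ 2 + vcoef n k.+1 =
    if (n <= k.+1)%N then (n.+1)%:Z else 0.
Proof.
case: k => // k /= kn; have -> : n = (k.+1 + (n - k.+1))%N by rewrite subnKC.
case: (n - k.+1)%N => [|[|m]] {kn n}.
- rewrite addn0 leqnSn vcoef_diag (vcoef_gt _ k.+2) // (vcoefE k.+1 k 0) ?addn1 //.
  by rewrite -!natz -!natr1; ring.
- rewrite addn1 leqnn vcoef_diag (vcoefE k.+2 k 1) ?addn2 //.
  rewrite (vcoefE k.+2 k.+1 0) ?addn1 //.
  by rewrite -!natz -!natr1; ring.
rewrite ifF; last by rewrite !addnS !ltnS addSn ltnNge leq_addr.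
have e0 : (k.+1 + m.+2 = k + m.+3)%N by rewrite addSnnS.
have e2 : (k.+1 + m.+2 = k.+2 + m.+1)%N by rewrite [RHS]addSnnS.
rewrite (vcoefE _ k m.+2) // (vcoefE _ k.+1 m.+1) // (vcoefE _ k.+2 m) // !exprS.
by rewrite -!natz -!natr1; ring.
Qed.

(** * Diagonal lattices *)

Definition craig_lat (n c q : nat) : set 'cV[rat]_n :=
  [set x | exists (a : nat -> int) (b : int),
     [/\ forall k, (0 < k < n)%N -> (c %| a k)%Z, (q %| b)%Z &
         x = craig_comb n a b]]%classic.

Lemma lat_comb (n c q : nat) (a : nat -> int) (b : int) : (0 < n)%N ->
  craig_lat n c q (craig_comb n a b) <->
  (forall k, (0 < k < n)%N -> (c %| a k)%Z) /\ (q %| b)%Z.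
Proof.
move=> n0; split=> [[a' [b' [ca qb /(comb_inj _ _ _ _ _ n0) [ea ->]]]]|[ca qb]].
  by split=> // k kn; rewrite ea // ca.
by exists a, b.
Qed.

Lemma craig_L_craig_lat (n d : nat) : craig_L n d = craig_lat n d 1.
Proof.
apply/seteqP; split=> x [a [b]].
  move=> ->; exists (fun k => d%:Z * a k), b; split=> [k _||].
  - exact: dvdz_mulr.
  - exact: dvd1z.
  congr (_ + _); apply: eq_bigr => i _.
  by rewrite -!scaler_int scalerA rmorphM /= mulrC.
case=> da _ ->; exists (fun k => (a k %/ d)%Z), b.
congr (_ + _); apply: eq_big_nat => i /da di.
by rewrite -!scaler_int scalerA -[in LHS](divzK di) rmorphM.
Qed.

Lemma comb0 (n : nat) : craig_comb n (fun=> 0) 0 = 0.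
Proof. by rewrite /craig_comb big1 ?add0r ?mulr0z // => i _; rewrite mulr0z. Qed.

Lemma lat_subgroup (n c q : nat) : subgroup (craig_lat n c q).
Proof.
split=> [|x y [a [b [ca qb ->]]] [a' [b' [ca' qb' ->]]]].
  by exists (fun=> 0), 0; split=> [k _||]; rewrite ?dvdz0 ?comb0.
rewrite combB; exists (fun k => a k - a' k), (b - b').
split=> // [k kn|]; last exact: rpredB.
by apply: rpredB; [exact: ca | exact: ca'].
Qed.

Lemma e_comb (n k : nat) (r : int) : (0 < k < n)%N ->
  e_ n k *~ r = craig_comb n (fun i => (i == k)%:R * r) 0.
Proof.
move=> kn; rewrite /craig_comb mulr0z addr0.
rewrite (bigD1_seq k) ?mem_index_iota ?iota_uniq //= eqxx mul1r.
by rewrite big1 ?addr0 // => i /negbTE ->; rewrite mul0r mulr0z.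
Qed.

(** Solves the definition of v for e_n, the one e_k outside the basis. *)
Lemma e_last_comb (n : nat) (r : int) : (0 < n)%N ->
  e_ n n *~ r = craig_comb n (fun i => - (r * vcoef n i)) r.
Proof.
move=> n0; apply: ecoord_ext => k kn.
rewrite ecoord_comb // -scaler_int ecoordZ ecoord_e kn andbT /trunc_coef.
have [<-|nk] := eqVneq n k; first by rewrite ltnn andbF /vcoef eqxx add0r !mulr1.
rewrite (_ : (0 < k < n)%N); last by move: nk kn; lia.
by rewrite addNr mulr0.
Qed.

(** The vector e_n has v-coordinate 1, so for k = n divisibility of r by q is required as well; this
    is where q | c enters. *)
Lemma lat_e (n c q k : nat) (r : int) : (q %| c)%N -> (c %| r)%Z ->
  (0 < k <= n)%N -> craig_lat n c q (e_ n k *~ r).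
Proof.
move=> qc cr kn; have n0 : (0 < n)%N by lia.
have [e|nk] := eqVneq k n; last first.
  rewrite e_comb; last by move: nk kn; lia.
  by apply/lat_comb => //; split=> [j _|]; [exact: dvdz_mull | exact: dvdz0].
rewrite e e_last_comb //; apply/lat_comb => //; split=> [j _|].
  by rewrite rpredN; apply: dvdz_mulr.
exact: dvdz_trans cr.
Qed.

(* The e_k-coefficient of x + (k k+1) x for x = craig_comb n a b. *)
Definition reflection_coef (n : nat) (a : nat -> int) (b : int) (k : nat) : int :=
  trunc_coef n a k.-1 + trunc_coef n a k *+ 2 + trunc_coef n a k.+1 +
  b * (if (n <= k.+1)%N then (n.+1)%:Z else 0).

Lemma specht_action_comb (n k : nat)
    (rG : mx_representation rat [set: 'S_n.+1]%SET n) (a : nat -> int) (b : int) :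
  specht_action rG -> (0 < k <= n)%N ->
  rG (adj_transp n k) *m craig_comb n a b =
    e_ n k *~ reflection_coef n a b k - craig_comb n a b.
Proof.
move=> act kn; have n0 : (0 < n)%N by lia.
rewrite (specht_action_mul _ _ _ _ act) // -scaler_int; congr (_ *: _ - _).
rewrite !ecoord_comb // /reflection_coef -(vcoef_reflection _ _ kn).
by rewrite -rmorphMn -!rmorphD; congr (_%:~R); ring.
Qed.

Lemma reflection_coef_dvd (n c q k : nat) (a : nat -> int) (b : int) :
  (0 < k)%N -> (forall k, (0 < k < n)%N -> (c %| a k)%Z) -> (c %| b * (n.+1)%:Z)%Z ->
  (c %| reflection_coef n a b k)%Z.
Proof.
move=> k0 ca cb; have ct j : (c %| trunc_coef n a j)%Z.
  by rewrite /trunc_coef; case: ifP => [/ca|] //; rewrite dvdz0.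
rewrite /reflection_coef; apply: rpredD; last first.
  by case: ifP => // _; rewrite mulr0 dvdz0.
by apply: rpredD => //; apply: rpredD => //; apply: rpredMn.
Qed.

Lemma stable_adj_transp (n : nat) (rG : mx_representation rat [set: 'S_n.+1]%SET n)
    (N : set 'cV[rat]_n) :
  (forall k x, (0 < k <= n)%N -> N x -> N (rG (adj_transp n k) *m x)) ->
  forall g x, N x -> N (rG g *m x).
Proof.
move=> Nadj g; have : g \in <<[set adj_transp n k.+1 | k : 'I_n]>>%g.
  by rewrite gen_adj_transp inE.
case/gen_prodgP => m [f fA ->].
elim/big_rec: _ => [|i h _ IH] x Nx; first by rewrite repr_mx1 mul1mx.
rewrite repr_mxM ?inE // -mulmxA; have /imsetP[k _ ->] := fA i.
by apply: Nadj (IH _ Nx); exact: ltn_ord.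
Qed.

(** Inclusion comes from d | c. As c | (n+1) q, every x + (k k+1) x is a multiple of c e_k, and c
    e_k lies in the lattice because q | c. *)
Lemma lat_ZG_sublattice (n d c q : nat)
    (rG : mx_representation rat [set: 'S_n.+1]%SET n) :
  (0 < n)%N -> specht_action rG ->
  (d %| c)%N -> (q %| c)%N -> (c %| n.+1 * q)%N ->
  ZG_sublattice rG (craig_L n d) (craig_lat n c q).
Proof.
move=> n0 act dc qc cq; have [N0 NB] := lat_subgroup n c q.
split=> //; first rewrite craig_L_craig_lat => _ [a [b [ca qb ->]]].
  apply/lat_comb => //; split=> [k /ca|]; last exact: dvd1z.
  exact: dvdz_trans.
apply: stable_adj_transp => k x kn Nx.
case: (Nx) => a [b [ca qb xE]]; rewrite {1}xE (specht_action_comb _ _ _ _ _ act) //.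
rewrite -xE; apply: NB => //; apply: lat_e => //.
apply: reflection_coef_dvd => //; first by case/andP: kn.
rewrite mulrC; apply: dvdz_trans (dvdz_mul (dvdzz _) qb).
by rewrite -PoszM.
Qed.

(** Test on c e_1 and q v; n >= 2 ensures that e_1 is one of the basis vectors. *)
Lemma lat_le (n c q c' q' : nat) : (2 <= n)%N ->
  (craig_lat n c q `<=` craig_lat n c' q')%classic -> (c' %| c)%N /\ (q' %| q)%N.
Proof.
move=> n2 le; have n0 : (0 < n)%N by apply: ltnW.
split.
  have /le /(lat_comb _ _ _ _ _ n0) [/(_ 1%N n2)] // :
    craig_lat n c q (craig_comb n (fun=> c) 0).
  by apply/lat_comb; rewrite ?dvdz0.
have /le /(lat_comb _ _ _ _ _ n0) [_] // :
  craig_lat n c q (craig_comb n (fun=> 0) q).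
by apply/lat_comb => //; split=> [k _|]; rewrite ?dvdz0.
Qed.

Lemma lat_inj (n c q c' q' : nat) : (2 <= n)%N ->
  craig_lat n c q = craig_lat n c' q' -> c = c' /\ q = q'.
Proof.
move=> n2 e.
have [h1 h2] : (c' %| c)%N /\ (q' %| q)%N by apply: lat_le n2 _; rewrite e.
have [h3 h4] : (c %| c')%N /\ (q %| q')%N by apply: lat_le n2 _; rewrite e.
by split; apply/eqP; rewrite eqn_dvd ?h1 ?h2 ?h3 ?h4.
Qed.

Lemma residue_ord (q : nat) (b : int) : (0 < q)%N ->
  exists r : 'I_q, (q %| b - r%:Z)%Z.
Proof.
move=> q0; have lt : (`|(b %% q)%Z|%N < q)%N.
  by rewrite -ltz_nat gez0_abs ?modz_ge0 ?ltz_pmod //; lia.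
exists (Ordinal lt); rewrite /= gez0_abs ?modz_ge0 //; last lia.
by rewrite {1}(divz_eq b q) addrK dvdz_mull.
Qed.

Lemma residue_ord_inj (q : nat) (r r' : 'I_q) : (q %| r%:Z - r'%:Z)%Z -> r = r'.
Proof.
move=> h; apply: val_inj => /=; have [rq rq'] := (ltn_ord r, ltn_ord r').
case/dvdzP: h => k e.
have : k = 0 by nia.
by move=> k0; move: e; rewrite k0 mul0r => /eqP; rewrite subr_eq0 => /eqP [].
Qed.

Lemma lat_index (n d u q : nat) : (0 < n)%N -> (0 < d)%N -> (0 < u)%N -> (0 < q)%N ->
  has_index (craig_lat n d 1) (craig_lat n (u * d) q) (u ^ (n - 1) * q)%N.
Proof.
move=> n0 d0 u0 q0.
(* Transversal: the coefficient of e_k is d times a digit below u, that of v a residue below q. The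
   digit for e_k has index k-1, with default 0 outside the range. *)
pose T := ({ffun 'I_(n - 1) -> 'I_u} * 'I_q)%type.
pose a (t : T) k : int :=
  d%:Z * oapp (fun j : 'I_(n - 1) => (t.1 j : nat)%:Z) 0 (insub k.-1).
have aS (t : T) (j : 'I_(n - 1)) : a t j.+1 = d%:Z * (t.1 j : nat)%:Z.
  by rewrite /a /= valK.
have aP k : (0 < k < n)%N -> exists j : 'I_(n - 1), k = j.+1.
  case: k => // k kn; have kn1 : (k < n - 1)%N by lia.
  by exists (Ordinal kn1).
have -> : (u ^ (n - 1) * q)%N = #|{: T}| by rewrite card_prod card_ffun !card_ord.
apply: (has_index_card _ _ _ (fun t : T => craig_comb n (a t) (t.2 : nat)%:Z)).
- exact: lat_subgroup.
- move=> t; apply/lat_comb => //; split=> [k _|]; last exact: dvd1z.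
  exact: dvdz_mulr.
- move=> [f r] [f' r']; rewrite combB => /(lat_comb _ _ _ _ _ n0) [/= ha hb].
  congr (_, _); last exact: residue_ord_inj.
  apply/ffunP => j; apply: residue_ord_inj.
  have jn : (0 < j.+1 < n)%N by have := ltn_ord j; lia.
  have := ha _ jn; rewrite !aS -mulrBr [(u * d)%N]mulnC PoszM dvdz_mul2l //; lia.
move=> _ [b [z [db _ ->]]].
have [r zr] := residue_ord q z q0.
have : forall j : 'I_(n - 1), exists r : 'I_u, (u %| (b j.+1 %/ d)%Z - r%:Z)%Z.
  by move=> j; apply: residue_ord.
case/fin_all_exists => f hf; exists ([ffun j => f j], r).
rewrite combB; apply/lat_comb => //; split=> // k kn.
have [j kj] := aP k kn; rewrite kj in kn *; rewrite aS ffunE -(divzK (db _ kn)).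
by rewrite [_ * d%:Z]mulrC -mulrBr [(u * d)%N]mulnC PoszM; apply: dvdz_mul.
Qed.

(** * Classification of the sublattices of finite index *)

(** The coefficient at k is the pairing with e_k for the Gram matrix with 2 on the diagonal and 1
    beside it. The hypothesis thus puts the vector in c times the dual (weight) lattice, and the
    conclusion describes this in the basis e_1, ..., e_{n-1}, v. *)
Lemma dvd_reflection_coefs (n c : nat) (a : nat -> int) (b : int) : (2 <= n)%N ->
  (forall k, (0 < k <= n)%N -> (c %| reflection_coef n a b k)%Z) ->
  (forall k, (0 < k < n)%N -> (c %| a k)%Z) /\ (c %| b * (n.+1)%:Z)%Z.
Proof.
case: n => [|[|n]] // _ cL.
(* The last two coefficients differ by g n, and the earlier ones are sums of two
   consecutive values of g: descend. *)
pose g k := trunc_coef n.+2 a k + trunc_coef n.+2 a k.+1.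
have t0 : trunc_coef n.+2 a 0 = 0 by [].
have tn k : (n.+2 <= k)%N -> trunc_coef n.+2 a k = 0.
  by move=> nk; rewrite /trunc_coef [(k < _)%N]ltnNge nk andbF.
have cg j : (j <= n)%N -> (c %| g (n - j)%N)%Z.
  elim: j => [_|j IH jn].
    have -> : g (n - 0)%N =
        reflection_coef n.+2 a b n.+1 - reflection_coef n.+2 a b n.+2.
      rewrite /g /reflection_coef subn0 /= ltnSn leqnSn.
      by rewrite (tn n.+2) // (tn n.+3) //; ring.
    by apply: rpredB; apply: cL; rewrite ltnS ?leqnSn ?leqnn.
  have -> : g (n - j.+1)%N = reflection_coef n.+2 a b (n - j) - g (n - j)%N.
    rewrite /g /reflection_coef -(subnSK jn) /= ifF; last by lia.
    by ring.
  by apply: rpredB; [apply: cL; lia | apply: IH; lia].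
(* Ascend from the vanishing entry at 0: each entry is a consecutive sum [g k] minus the previous
   entry. *)
have ct k : (k <= n.+1)%N -> (c %| trunc_coef n.+2 a k)%Z.
  elim: k => [|k IH] kn; first by rewrite t0.
  have -> : trunc_coef n.+2 a k.+1 = g k - trunc_coef n.+2 a k.
    by rewrite /g addrC addKr.
  apply: rpredB; last exact: IH (ltnW kn).
  by have := cg (n - k)%N (leq_subr _ _); rewrite subKn // -ltnS.
split=> [k kn|]; first by have := ct k; rewrite /trunc_coef kn; apply; lia.
(* The top reflection coefficient consists of the last entry of [a] and this term alone. *)
have -> : b * (n.+3)%:Z = reflection_coef n.+2 a b n.+2 - trunc_coef n.+2 a n.+1.
  by rewrite /reflection_coef /= leqnSn (tn n.+2) // (tn n.+3) //; ring.
by apply: rpredB; [apply: cL; rewrite leqnn | apply: ct; rewrite ltnSn].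
Qed.

Lemma reflection_mem (n k : nat) (rG : mx_representation rat [set: 'S_n.+1]%SET n)
    (N : set 'cV[rat]_n) (x : 'cV[rat]_n) :
  specht_action rG -> subgroup N -> (forall g y, N y -> N (rG g *m y)) ->
  N x -> (0 < k <= n)%N ->
  N ((ecoord x k.-1 + ecoord x k *+ 2 + ecoord x k.+1) *: e_ n k).
Proof.
move=> act NG Nstable Nx kn.
have := subgroupD _ _ _ NG (Nstable (adj_transp n k) _ Nx) Nx.
by rewrite (specht_action_mul _ _ _ _ act) // subrK.
Qed.

(** Adding its (k k+1)-image to e_{k-1} or e_{k+1} gives e_k, so multiples move to neighbours; any
    two indices are joined through 1. *)
Lemma e_mem_shift (n : nat) (rG : mx_representation rat [set: 'S_n.+1]%SET n)
    (N : set 'cV[rat]_n) (r : int) (k l : nat) :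
  specht_action rG -> subgroup N -> (forall g y, N y -> N (rG g *m y)) ->
  (0 < k <= n)%N -> (0 < l <= n)%N -> N (e_ n k *~ r) -> N (e_ n l *~ r).
Proof.
move=> act NG Nstable.
have refl x i := reflection_mem n i rG N x act NG Nstable.
have coordE i j : ecoord (e_ n i *~ r) j = r%:~R * ((i == j) && (0 < j <= n))%N%:R.
  by rewrite -scaler_int ecoordZ ecoord_e.
have up i : (0 < i < n)%N -> N (e_ n i *~ r) -> N (e_ n i.+1 *~ r).
  case/andP=> i0 ilt Ni; have := refl _ i.+1 Ni ilt.
  rewrite !coordE /= eqxx i0 (ltnW ilt) !ltn_eqF //.
  by rewrite !mulr0 mulr1 mul0rn !addr0 scaler_int.
have down i : (0 < i < n)%N -> N (e_ n i.+1 *~ r) -> N (e_ n i *~ r).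
  case/andP=> i0 ilt Ni; have ile : (0 < i <= n)%N by rewrite i0 ltnW.
  have := refl _ i Ni ile.
  rewrite !coordE /= eqxx ilt !gtn_eqF ?ltnS ?leq_pred //.
  by rewrite !mulr0 mulr1 mul0rn !add0r scaler_int.
have to1 i : (0 < i <= n)%N -> N (e_ n i *~ r) -> N (e_ n 1 *~ r).
  elim: i => // -[|i] IH ir //; move/down => h; apply: IH; first by lia.
  by apply: h; lia.
have from1 i : (0 < i <= n)%N -> N (e_ n 1 *~ r) -> N (e_ n i *~ r).
  elim: i => // -[|i] IH ir // N1; apply: up; first by lia.
  by apply: IH => //; lia.
by move=> kn ln /(to1 _ kn) /(from1 _ ln).
Qed.

(** Here c and q generate the ideals of all r with r e_1 in N and of all b with b v in N.
    Reflections force N into [craig_lat n c q]; conversely the c e_k and q v lie in N. *)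
Lemma sublattice_craig_lat (n d m : nat)
    (rG : mx_representation rat [set: 'S_n.+1]%SET n)
    (N : set 'cV[rat]_n) :
  (2 <= n)%N -> specht_action rG -> ZG_sublattice rG (craig_L n d) N ->
  has_index (craig_L n d) N m ->
  exists c q : nat,
  [/\ (0 < c)%N /\ (0 < q)%N, (d %| c)%N, (q %| c)%N, (c %| n.+1 * q)%N &
      N = craig_lat n c q].
Proof.
move=> n2 act [NM N0 NB Nstable] Nm; have n0 : (0 < n)%N by apply: ltnW.
have NG : subgroup N by split.
have e_mem r k l := e_mem_shift n rG N r k l act NG Nstable.
rewrite craig_L_craig_lat in NM.
have lap a b k : N (craig_comb n a b) -> (0 < k <= n)%N ->
    N (e_ n 1 *~ reflection_coef n a b k).
  move=> Nab kn; apply: (e_mem _ k) => //.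
  have := subgroupD _ _ _ NG (Nstable (adj_transp n k) _ Nab) Nab.
  by rewrite (specht_action_comb _ _ _ _ _ act) // subrK.
have combv b : craig_v n *~ b = craig_comb n (fun=> 0) b.
  by rewrite /craig_comb big1 ?add0r // => i _; rewrite mulr0z.
have mulz_subgroup (x : 'cV[rat]_n) : subgroup [set r : int | N (x *~ r)]%classic.
  by split=> [|r s Nr Ns] /=; rewrite ?mulr0z // mulrzBr; apply: NB.
(* Finite index supplies a positive multiple of v in N, which makes both ideals nonzero. *)
have [e e0 Ne] : exists2 e : nat, (0 < e)%N & N (craig_v n *+ e).
  apply: (has_index_torsion (craig_L n d) _ m) => //.
    by rewrite craig_L_craig_lat; exact: lat_subgroup.
  by rewrite craig_L_craig_lat -[craig_v n]mulr1z combv; apply/lat_comb => //.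
rewrite pmulrn in Ne.
have [q q0 Bq] : exists2 q : nat, (0 < q)%N &
    forall b, N (craig_v n *~ b) <-> (q %| b)%Z.
  apply: (subgroup_int_dvd _ (mulz_subgroup (craig_v n))).
  by exists e; rewrite // eqz_nat -lt0n.
have [c c0 Ic] : exists2 c : nat, (0 < c)%N &
    forall r, N (e_ n 1 *~ r) <-> (c %| r)%Z.
  apply: (subgroup_int_dvd _ (mulz_subgroup (e_ n 1))).
  (* This number is e (n+1): reflecting the multiple [e] of v at k = n gives e (n+1) e_n, which
     moves to e_1. *)
  exists (reflection_coef n (fun=> 0) e n).
    by apply: lap; rewrite -?combv ?n0 ?leqnn.
  rewrite /reflection_coef /trunc_coef !if_same leqnSn !add0r -PoszM.
  rewrite eqz_nat muln_eq0.
  by case: (e) e0.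
have ce a b : N (craig_comb n a b) ->
    (forall k, (0 < k < n)%N -> (c %| a k)%Z) /\ (c %| b * (n.+1)%:Z)%Z.
  by move=> Nab; apply: dvd_reflection_coefs => // k kn; apply/Ic; apply: lap.
have Nsum a : (forall k, (0 < k < n)%N -> (c %| a k)%Z) ->
    N (\sum_(1 <= i < n) e_ n i *~ a i).
  move=> ca; rewrite big_nat; apply: (big_rec (fun x => N x)) => // i x ir Nx.
  apply: (subgroupD _ _ _ NG) Nx; apply: (e_mem _ 1); rewrite ?n0 //; first by lia.
  exact/Ic/ca.
(* By [ce] the e_i-part of the vector is itself in N; subtracting it leaves b v. *)
have bq a b : N (craig_comb n a b) -> (q %| b)%Z.
  move=> Nab; have [ca _] := ce _ _ Nab; apply/Bq.
  by have := NB _ _ Nab (Nsum _ ca); rewrite /craig_comb addrC addKr.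
exists c, q; split=> //.
- have : N (e_ n 1 *~ c) by apply/Ic.
  rewrite e_comb ?n2 // => /NM /(lat_comb _ _ _ _ _ n0) [/(_ 1%N n2) + _].
  by rewrite eqxx mul1r.
(* In the basis, c e_n has v-coordinate c. *)
- have : N (e_ n n *~ c) by apply: (e_mem _ 1); rewrite ?n0 ?leqnn //; apply/Ic.
  by rewrite e_last_comb // => /bq.
- have : N (craig_v n *~ q) by apply/Bq.
  by rewrite combv => /ce [_]; rewrite -PoszM mulnC.
apply/seteqP; split=> [x Nx|_ [a [b [ca qb ->]]]].
  have [a [b [_ _ xE]]] := NM _ Nx; rewrite xE in Nx *.
  by apply/lat_comb => //; split; [exact: (proj1 (ce _ _ Nx)) | exact: bq Nx].
by apply: (subgroupD _ _ _ NG (Nsum _ ca)); apply/Bq.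
Qed.

(** * Enumeration by k and D, and the count *)

Lemma has_index_inj {V : zmodType} (M N : set V) (m m' : nat) :
  has_index M N m -> has_index M N m' -> m = m'.
Proof.
move=> Mm Mm'; apply/card_eq_II; apply: card_eq_trans Mm'.
by rewrite card_eq_sym.
Qed.

Lemma card_set_seq {T : eqType} (s : seq T) :
  uniq s -> ([set` s] #= `I_(size s))%card.
Proof.
case: s => [_|x s us].
  have -> : [set` ([::] : seq T)]%classic = set0 by apply/seteqP; split.
  by rewrite II0 card_eq0.
have -> : [set` x :: s]%classic =
    [set nth x (x :: s) i | i in `I_(size (x :: s))]%classic.
  apply/seteqP; split=> y /=; first by move/(nthP x).
  by case=> i ilt <-; apply: mem_nth.
apply: inj_card_eq => i j /set_mem ilt /set_mem jlt /eqP.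
by rewrite nth_uniq // => /eqP.
Qed.

(* D is the order of the image in the weight lattice modulo the root lattice. *)
Definition craig_sub (n d k D : nat) : set 'cV[rat]_n :=
  craig_lat n (k * (D %/ gcdn d D) * d) (k * (d %/ gcdn d D)).

(** With c and q the two parameters of [craig_sub], D is the ratio c / q; hence the lattice
    determines D, and then k through q. *)
Lemma craig_sub_ratio (d k D : nat) :
  (k * (D %/ gcdn d D) * d = D * (k * (d %/ gcdn d D)))%N.
Proof. by rewrite -mulnA [RHS]mulnCA [(_ * d)%N]mulnC muln_divCA_gcd. Qed.

Lemma craig_sub_index (n d k D : nat) : (0 < n)%N ->
  ((k * (D %/ gcdn d D)) ^ (n - 1) * (k * (d %/ gcdn d D)) =
   k ^ n * primitive_index n d D)%N.
Proof.
case: n => // n _; rewrite /primitive_index subn1 /= expnMn expnS; ring.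
Qed.

Lemma craig_sub_inj (n d k D k' D' : nat) :
  (2 <= n)%N -> (0 < d)%N -> (0 < k)%N ->
  craig_sub n d k D = craig_sub n d k' D' -> (k, D) = (k', D').
Proof.
move=> n2 d0 k0 /(lat_inj _ _ _ _ _ n2) []; rewrite !craig_sub_ratio => ec eq.
have d'0 x : (0 < d %/ gcdn d x)%N.
  by rewrite divn_gt0 ?gcdn_gt0 ?d0 // dvdn_leq // dvdn_gcdl.
have eD : D = D'.
  have q0 : (0 < k * (d %/ gcdn d D))%N by rewrite muln_gt0 k0 d'0.
  by apply/eqP; rewrite -(eqn_pmul2r q0) ec eq.
move: eq; rewrite eD => /eqP; rewrite eqn_pmul2r // => /eqP->.
by [].
Qed.

Lemma sublattices_of_indexE (n d m : nat)
    (rG : mx_representation rat [set: 'S_n.+1]%SET n) :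
  (2 <= n)%N -> (0 < d)%N -> (0 < m)%N -> specht_action rG ->
  sublattices_of_index rG (craig_L n d) m =
  [set craig_sub n d kD.1 kD.2 | kD in
    [set` [seq kD <- [seq (k, D) | k <- iota 1 m, D <- divisors n.+1]
          | (kD.1 ^ n * primitive_index n d kD.2 == m)%N]]]%classic.
Proof.
move=> n2 d0 m0 act; have n0 : (0 < n)%N by apply: ltnW.
have gcd_div x : (0 < d %/ gcdn d x)%N.
  by rewrite divn_gt0 ?gcdn_gt0 ?d0 // dvdn_leq // dvdn_gcdl.
apply/seteqP; split=> [N [NL Nm]|_ [[k D] /= + <-]]; last first.
  rewrite mem_filter => /andP[/eqP km] /allpairsP[[? ?] [/= + + [ek eD]]].
  rewrite -ek -eD mem_iota -dvdn_divisors // => /andP[k0 _] Dn.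
  have D0 : (0 < D)%N by apply: dvdn_gt0 Dn.
  have D'0 : (0 < D %/ gcdn d D)%N.
    by rewrite divn_gt0 ?gcdn_gt0 ?d0 // dvdn_leq // dvdn_gcdr.
  split; last first.
    rewrite -km -(craig_sub_index _ _ _ _ n0) craig_L_craig_lat.
    by apply: lat_index; rewrite ?muln_gt0 ?k0 //=.
  apply: lat_ZG_sublattice => //; first exact: dvdn_mull.
    by rewrite craig_sub_ratio dvdn_mull.
  by rewrite craig_sub_ratio dvdn_mul.
have [c [q [[c0 q0] dc qc cq NE]]] := sublattice_craig_lat _ _ _ _ _ n2 act NL Nm.
(* Writing c = D q turns the condition c | (n+1) q into D | n+1. *)
case/dvdnP: qc NE dc cq c0 => D -> NE dDq Dn; rewrite muln_gt0 => /andP[D0 _].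
rewrite dvdn_pmul2r // in Dn.
(* With g the gcd of d and D, d | D q gives that d/g divides (D/g) q, and d/g is coprime to D/g. The
   cofactor of d/g in q is the parameter k. *)
have : (d %/ gcdn d D %| q)%N.
  rewrite -(@Gauss_dvdr _ (D %/ gcdn d D)); last first.
    rewrite /coprime -(@eqn_pmul2r (gcdn d D)) ?gcdn_gt0 ?d0 // mul1n.
    by rewrite muln_gcdl !divnK ?dvdn_gcdl ?dvdn_gcdr.
  rewrite -(@dvdn_pmul2r (gcdn d D)) ?gcdn_gt0 ?d0 // mulnAC.
  by rewrite !divnK ?dvdn_gcdl ?dvdn_gcdr.
case/dvdnP => k kE; have k0 : (0 < k)%N by move: q0; rewrite kE; case: (k).
have NE' : N = craig_sub n d k D by rewrite NE /craig_sub craig_sub_ratio -kE.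
exists (k, D) => //=; rewrite mem_filter /=.
have km : (k ^ n * primitive_index n d D)%N = m.
  apply: has_index_inj Nm; rewrite -craig_sub_index // craig_L_craig_lat NE'.
  apply: lat_index; rewrite ?muln_gt0 ?k0 //=.
  by rewrite divn_gt0 ?gcdn_gt0 ?d0 // dvdn_leq // dvdn_gcdr.
rewrite km eqxx /=; apply/allpairsP; exists (k, D).
rewrite mem_iota -dvdn_divisors //; split=> //=.
(* The search range k <= m suffices, as the index is at least k^n >= k. *)
rewrite k0 add1n ltnS -km; apply: leq_trans (leq_pmulr _ _).
  by rewrite -{1}(expn1 k) leq_pexp2l.
exact: primitive_index_gt0.
Qed.

(** Only k <= k^n = m can contribute. The bound [M] is separate from m so that one list serves all
    divisors of a given number in a convolution. *)
Lemma ds_scale_riemann_zeta (n M m : nat) : (0 < n)%N -> (0 < m <= M)%N ->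
  ds_scale n riemann_zeta m = ds_of_seq [seq (k ^ n)%N | k <- iota 1 M] m.
Proof.
move=> n0 /andP[m0 mM]; rewrite /ds_scale /riemann_zeta /ds_of_seq count_map.
rewrite -[RHS]natz -sum1_count natr_sum.
rewrite -(big_mkord (fun k => (0 < k)%N && (k ^ n == m)%N) (fun=> 1)).
rewrite (big_nat_widen _ _ M.+1) ?ltnS // big_ltn_cond //=.
rewrite /index_iota subn1 /= big_seq_cond [RHS]big_seq_cond.
apply: eq_bigl => k; rewrite mem_iota -andbA; case: posnP => //= k0.
rewrite andbA; case: eqP => [<-|]; rewrite ?andbF ?andbT //= ltnS.
have -> : (k <= k ^ n)%N by rewrite -{1}(expn1 k) leq_pexp2l.
by rewrite andbT.
Qed.

(** The finiteness clause makes the coefficients of [solomon_zeta] genuine counts, [fset_set] being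
    empty on infinite sets. *)
Theorem theorem1 (n d : nat)
    (rG : mx_representation rat [set: 'S_n.+1]%SET n) :
  (2 <= n)%N -> (0 < d)%N -> (d %| n.+1)%N ->
  specht_action rG ->
  (forall m : nat, (0 < m)%N ->
     finite_set (sublattices_of_index rG (craig_L n d) m)) /\
  dseries_eq
    (solomon_zeta rG (craig_L n d))
    (ds_mul (ds_scale n riemann_zeta)
       (\big[ds_mul/ds_one]_(p <- primes n.+1) ds_poly p (varphi n p d))).
Proof.
move=> n2 d0 dn act; have n0 : (0 < n)%N by apply: ltnW.
split=> m m0.
  by rewrite sublattices_of_indexE //; apply: finite_image; apply: finite_seq.
rewrite /solomon_zeta sublattices_of_indexE //.
set s := filter _ _; have us : uniq s.
  rewrite filter_uniq // allpairs_uniq ?iota_uniq ?divisors_uniq //.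
  by move=> [? ?] [? ?] _ _ [-> ->].
have sk kD : kD \in s -> (0 < kD.1)%N.
  rewrite mem_filter => /andP[_ /allpairsP[[k D] [/= + _ ->]]].
  by rewrite mem_iota => /andP[].
rewrite (card_fset_set (n := size s)); last first.
  apply: card_eq_trans (card_set_seq s us).
  apply: inj_card_eq => -[k D] [k' D'] /set_mem /sk k0 _.
  exact: craig_sub_inj.
have allp : all prime (primes n.+1).
  by apply/allP => p; rewrite mem_primes => /and3P[].
have prodE := prod_ds_poly_varphi n d (primes n.+1) d0 dn allp (primes_uniq _).
rewrite !prod_primes_dvdn // in prodE.
(* At this fixed m the zeta factor is replaced by the list of k^n with k <= m, since the convolution
   reads it at divisors of m only. *)
rewrite (eq_ds_mul _ (ds_of_seq [seq (k ^ n)%N | k <- iota 1 m]) _ _ m m0 _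
  (fun k km => prodE k (dvdn_gt0 m0 km))); last first.
  move=> k km; apply: ds_scale_riemann_zeta => //.
  by rewrite (dvdn_gt0 m0 km) dvdn_leq.
rewrite ds_mul_seq //; last first.
  apply/allP => _ /mapP[k + ->]; rewrite mem_iota => /andP[k0 _].
  by rewrite expn_gt0 k0.
(* Both sides now count the pairs (k, D) for which k^n times [primitive_index n d D] equals m. *)
rewrite /ds_of_seq allpairs_mapl allpairs_mapr size_filter.
rewrite -[in RHS](map_allpairs
  (fun kD => (kD.1 ^ n * primitive_index n d kD.2)%N) pair).
by rewrite count_map.
Qed.
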